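(* Let $b$ and $n$ be positive integers, let $p$ be a prime number, and write $b=p^{m}b'$ with $m\ge 0$ and $p\nmid b'$. Let $C_b(n):=nb^n+1$. If $C_b(n)$ is prime, then one of the following holds: (i) $(-n)^{b^n/p^i}\equiv 1 \pmod{C_b(n)}$ for every $i\in\{0,\dots,nm\}$; (ii) there exists an integer $K$ with $0\le K<mn$ such that $(-n)^{b^n/p^i}\equiv 1 \pmod{C_b(n)}$ for every $i\in\{0,\dots,K\}$ and $\Phi_p\big((-n)^{b^n/p^{K+1}}\big)\equiv 0 \pmod{C_b(n)}$.
   Context: $\Phi_p(x)=1+x+\cdots+x^{p-1}$ denotes the $p$-th cyclotomic polynomial. The integers $C_b(n) = nb^n+1$ are called Generalized Cullen Numbers. *)

(* Defs.v *)
From mathcomp Require Import all_boot all_order all_algebra all_field.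

Set Implicit Arguments.
Unset Strict Implicit.
Unset Printing Implicit Defensive.

Import GRing.Theory.

Definition gen_cullen (b n : nat) : nat := n * b ^ n + 1.

Local Open Scope ring_scope.

(* For prime p, the library's cyclotomic polynomial 'Phi_p : {poly int} is
   1 + 'X + ... + 'X^(p-1). *)
Lemma Cyclotomic_prime (p : nat) : prime p -> 'Phi_p = \sum_(i < p) 'X^i.
Proof.
move=> p_pr; have p_gt0 := prime_gt0 p_pr.
have Phi1 : 'Phi_1 = 'X - 1 :> {poly int}.
  have := prod_Cyclotomic (isT : (0 < 1)%N).
  by rewrite /divisors /= big_seq1.
have X1_neq0 : 'X - 1 != 0 :> {poly int} by rewrite -polyC1 polyXsubC_eq0.
apply: (mulfI X1_neq0); rewrite -subrX1 -(prod_Cyclotomic p_gt0).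
have Dp : perm_eq (divisors p) [:: 1%N; p].
  apply: uniq_perm; rewrite ?divisors_uniq //=.
    by rewrite inE andbT neq_ltn prime_gt1.
  move=> d; rewrite -dvdn_divisors // !inE.
  by case/primeP: p_pr => _ dvp; apply/idP/idP => [/dvp|/orP[]/eqP->].
by rewrite (perm_big _ Dp) /= big_cons big_seq1 Phi1.
Qed.

(* Main.v *)
Require Import Defs.
From mathcomp Require Import all_boot all_order all_algebra all_field.
From mathcomp Require Import cyclic ring.

(** Let [C = n * b ^ n + 1] be prime. Modulo [C] the residue [- n] is the inverse
    of [b ^ n], so [(- n) ^ (b ^ n)] is the inverse of [b ^ (n * b ^ n)], which is
    [b ^ (C - 1)], and this is [1] by Fermat's little theorem
    ([gen_cullen_exp_eq1]).

    Dividing the exponent [b ^ n] by [p] repeatedly, which is possible [n * m]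
    times, produces a sequence that starts at [1] and in which each term is the
    [p]-th power of the next ([divn_expnSr]). Either every term is [1], or there
    is a first term [y] distinct from [1]. As [y ^ p] is then [1] and
    [X ^ p - 1] is [(X - 1)] times the [p]-th cyclotomic polynomial, that polynomial
    vanishes at [y] modulo the prime [C] ([Cyclotomic_prime_root_mod]). *)

Import GRing.Theory.

Lemma eqz_mod_dvdn_abs (q : nat) (y z : int) :
  (y == z %[mod Posz q])%Z = (q %| `|(y - z)%R|)%N.
Proof. by rewrite eqz_mod_dvd. Qed.

(** The integers modulo a prime [q] form a domain, so in
    [y ^ p - 1 = (y - 1) * 'Phi_p.[y]] one of the two factors is zero. *)
Lemma Cyclotomic_prime_root_mod (p q : nat) (y : int) :
    prime p -> prime q ->
    (y ^+ p = 1 %[mod Posz q])%Z -> (y != 1 %[mod Posz q])%Z ->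
  (('Phi_p).[y]%R = 0 %[mod Posz q])%Z.
Proof.
move=> p_pr q_pr /eqP yp1 y1; apply/eqP; move: yp1 y1.
rewrite !eqz_mod_dvdn_abs subr0 Cyclotomic_prime // horner_sum.
under [in X in _ -> _ -> X]eq_bigr do rewrite hornerXn.
by rewrite subrX1 abszM Euclid_dvdM // => /orP[->|].
Qed.

Lemma gen_cullen_coprime (b n : nat) : (0 < n)%N -> coprime b (gen_cullen b n).
Proof.
move=> n_gt0; apply: (@coprime_dvdl _ (n * b ^ n)).
  by rewrite dvdn_mull // dvdn_exp.
by rewrite /gen_cullen addn1 coprimenS.
Qed.

(** From [- n * b ^ n = 1], the [b ^ n]-th power of [- n] is inverse to
    [b ^ (n * b ^ n)]; the shape of [C] makes this exponent exactly [C - 1]. *)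
Lemma gen_cullen_exp_eq1 (b n : nat) :
    (0 < n)%N -> prime (gen_cullen b n) ->
  ((- Posz n) ^+ (b ^ n)%N = 1 %[mod Posz (gen_cullen b n)])%Z.
Proof.
move=> n_gt0 C_pr; set C := gen_cullen b n.
have fermat : (Posz b ^+ (n * b ^ n)%N = 1 %[mod Posz C])%Z.
  have := Euler_exp_totient (gen_cullen_coprime b n n_gt0).
  rewrite totient_prime // {1}/gen_cullen addn1 /= => /eqP.
  by rewrite -eqz_nat -!modz_nat -natz natrX natz => /eqP.
have inv : (- Posz n * Posz b ^+ n = 1 %[mod Posz C])%Z.
  apply/eqP; rewrite eqz_mod_dvd; apply/dvdzP; exists (- 1)%R.
  by rewrite /C /gen_cullen PoszD PoszM -[Posz (b ^ n)]natz natrX natz; ring.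
(* Multiplying by [b ^ (C - 1)], which is [1], completes each of the [b ^ n]
   factors [- n] to a product [- n * b ^ n]. *)
rewrite -[in LHS](mulr1 (_ ^+ _)%R) -modzMmr -[in LHS]fermat modzMmr exprM -exprMn.
by rewrite -modzXm inv modzXm expr1n.
Qed.

Lemma divn_expnSr (a p i : nat) :
  (0 < p)%N -> (p ^ i.+1 %| a)%N -> (a %/ p ^ i.+1 * p)%N = (a %/ p ^ i)%N.
Proof.
move=> p_gt0 /dvdnP[c ->].
by rewrite mulnK ?expn_gt0 ?p_gt0 // expnS mulnA mulnK ?expn_gt0 ?p_gt0.
Qed.

Theorem theorem1 (b n p m b' : nat) (b_gt0 : (0 < b)%N) (n_gt0 : (0 < n)%N)
    (p_prime : prime p) (b_eq : b = (p ^ m * b')%N) (p_ndvd : ~~ (p %| b')%N)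
    (C_prime : prime (gen_cullen b n)) :
  let C : int := Posz (gen_cullen b n) in
  let x : nat -> int :=
    fun i : nat => ((- Posz n) ^+ (b ^ n %/ p ^ i)%N)%R in
  (forall i : nat, (i <= n * m)%N -> (x i = 1 %[mod C])%Z) \/
  (exists K : nat,
    [/\ (K < m * n)%N,
        forall i : nat, (i <= K)%N -> (x i = 1 %[mod C])%Z
      & ((('Phi_p).[x K.+1])%R = 0 %[mod C])%Z]).
Proof.
move=> C x.
have x0 : (x 0%N = 1 %[mod C])%Z.
  by rewrite /x expn0 divn1; apply: gen_cullen_exp_eq1.
have xS i : (i < n * m)%N -> (x i.+1 ^+ p = x i)%R.
  move=> i_lt; rewrite /x -exprM divn_expnSr ?prime_gt0 //.
  by rewrite b_eq expnMn -expnM dvdn_mulr // dvdn_exp2l // mulnC.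
have [/existsP ex_neq1 | /existsPn all1] :=
  boolP [exists i : 'I_(n * m).+1, (x i != 1 %[mod C])%Z]; last first.
  left=> i i_le; apply/eqP.
  by have := all1 (Ordinal (i_le : i < (n * m).+1)%N); rewrite negbK.
right.
(* [K.+1] is the least index at which [x] leaves the class of [1]. *)
have ex_nat : exists i, (i <= n * m)%N && (x i != 1 %[mod C])%Z.
  by case: ex_neq1 => i xi; exists i; rewrite -ltnS ltn_ord.
case: (ex_minnP ex_nat) => -[|K] /andP[K_lt xK] minK.
  by rewrite x0 eqxx in xK.
have x_eq1 i : (i <= K)%N -> (x i = 1 %[mod C])%Z.
  move=> i_le; apply/eqP; apply: contraTT i_le => xi; rewrite -ltnNge.
  have [i_le | /(ltn_trans K_lt)//] := leqP i (n * m).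
  by apply: minK; rewrite i_le.
exists K; split=> //; first by rewrite mulnC.
by apply: Cyclotomic_prime_root_mod => //; rewrite xS // x_eq1.
Qed.
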